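(* Let $\epsilon > 0$. The set of $d \in S_6(\mathcal{B})$ such that $$\zeta_d > |d|^{43/246-\epsilon}$$ has natural density $1$ in $S_6(\mathcal{B})$ as $\mathcal{B} \to \infty$; that is, $$\lim_{\mathcal{B}\to\infty} \frac{\#\{d \in S_6(\mathcal{B}) : \zeta_d > |d|^{43/246-\epsilon}\}}{\#S_6(\mathcal{B})} = 1.$$
   Context: An integer $d$ is sixth-power free if $d \neq 0$ and no sixth power of a prime divides $d$. For real $\mathcal{B}>0$, $S_6(\mathcal{B}) = \{d \in \mathbb{Z} : |d| \le \mathcal{B},\ d \text{ sixth-power free}\}$. For sixth-power free $d \in \mathbb{Z}$, $E_d$ denotes the elliptic curve over $\mathbb{Q}$ given by $y^2z = x^3 + dz^3$. For an elliptic curve $E/\mathbb{Q}$, $\hat{h}_E$ is the canonical height in Silverman's normalization: $\hat{h}_E(P) = \frac12 \lim_{n\to\infty} 4^{-n} h(x([2^n]P))$, where $h$ is the logarithmic absolute height on $\mathbb{P}^1(\overline{\mathbb{Q}})$ and $x$ is a Weierstrass $x$-coordinate (so $h([a:b]) = \log\max(|a|,|b|)$ for coprime integers $a,b$). Define $\zeta_d$ by $\log \zeta_d = \min\{\hat{h}_{E_d}(P) : P \in E_d(\mathbb{Q}) \setminus E_d(\mathbb{Q})_{\mathrm{tors}}\}$, and $\zeta_d = \infty$ if $E_d(\mathbb{Q}) \setminus E_d(\mathbb{Q})_{\mathrm{tors}}$ is empty. *)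

(* Defs.v *)
From HB Require Import structures.
From mathcomp Require Import all_boot all_order all_algebra finmap.
From mathcomp Require Import all_classical all_reals all_analysis.
From mathcomp Require Import ring.
Import Order.TTheory GRing.Theory Num.Theory.
Import numFieldNormedType.Exports.

Set Implicit Arguments.
Unset Strict Implicit.
Unset Printing Implicit Defensive.

Local Open Scope classical_set_scope.
Local Open Scope ring_scope.

Definition sixth_power_free (d : int) : Prop :=
  d != 0 /\ forall p : nat, prime p -> ~~ ((p%:Z ^+ 6) %| d)%Z.

Definition S6 (R : realType) (B : R) : set int :=
  [set d : int | `|d|%:~R <= B /\ sixth_power_free d].

(* The curve y^2 z = x^3 + d z^3 meets the line z = 0 only in [0 : 1 : 0].
   That point is encoded by None, and [x : y : 1] by Some (x, y). *)
Definition on_curve (d : int) (P : option (rat * rat)) : bool :=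
  if P is Some (x, y) then y ^+ 2 == x ^+ 3 + d%:~R else true.

(* Chord-tangent addition; for y^2 = x^3 + d it does not involve d. *)
Definition add_coords (P Q : option (rat * rat)) : option (rat * rat) :=
  match P, Q with
  | None, _ => Q
  | _, None => P
  | Some (x1, y1), Some (x2, y2) =>
      if (x1 == x2) && (y1 == - y2) then None else
      let l := if x1 == x2 then (3 * x1 ^+ 2) / (2 * y1)
               else (y2 - y1) / (x2 - x1) in
      let x3 := l ^+ 2 - x1 - x2 in
      Some (x3, l * (x1 - x3) - y1)
  end.

Lemma on_curve_add (d : int) (P Q : option (rat * rat)) :
  on_curve d P -> on_curve d Q -> on_curve d (add_coords P Q).
Proof.
case: P => [[x1 y1]|] //; case: Q => [[x2 y2]|] //=.
rewrite /on_curve; move: (d%:~R : rat) => c /eqP h1 /eqP h2.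
have [e|ne] := eqVneq x1 x2 => /=; last first.
  have nz : x2 - x1 != 0 by rewrite subr_eq0 eq_sym.
  set l := (y2 - y1) / (x2 - x1).
  have hl : l * (x2 - x1) = y2 - y1 by rewrite /l divfK.
  apply/eqP/(mulfI nz)/eqP; rewrite -subr_eq0; apply/eqP.
  have -> : c = y1 ^+ 2 - x1 ^+ 3 by rewrite h1; ring.
  have h3 : y2 ^+ 2 - y1 ^+ 2 = x2 ^+ 3 - x1 ^+ 3 by rewrite h1 h2; ring.
  have hy : y2 = y1 + l * (x2 - x1) by rewrite hl; ring.
  have h4 : l * (2 * y1 + l * (x2 - x1)) = x2 ^+ 2 + x1 * x2 + x1 ^+ 2.
    by apply: (mulfI nz); transitivity (y2 ^+ 2 - y1 ^+ 2);
      [rewrite hy; ring | rewrite h3; ring].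
  transitivity ((x2 - x1) * (2 * x1 + x2 - l ^+ 2) *
    (x2 ^+ 2 + x1 * x2 + x1 ^+ 2 - l * (2 * y1 + l * (x2 - x1)))); first by ring.
  by rewrite h4; ring.
subst x2.
case: ifPn => // ne.
have ey : y2 = y1.
  have : (y1 - y2) * (y1 + y2) = 0.
    by transitivity (y1 ^+ 2 - y2 ^+ 2); [ring | rewrite h1 h2; ring].
  move/eqP; rewrite mulf_eq0 subr_eq0 addr_eq0 (negbTE ne) orbF.
  by move/eqP.
have nz : 2 * y1 != 0.
  by rewrite mulf_neq0 //; apply: contra ne => /eqP y0; rewrite ey y0 oppr0.
set l := 3 * x1 ^+ 2 / (2 * y1).
have hl : l * (2 * y1) = 3 * x1 ^+ 2 by rewrite /l divfK.
have -> : c = y1 ^+ 2 - x1 ^+ 3 by rewrite h1; ring.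
rewrite -subr_eq0; apply/eqP.
transitivity ((3 * x1 - l ^+ 2) * (3 * x1 ^+ 2 - l * (2 * y1))); first by ring.
by rewrite hl; ring.
Qed.

(* E_d(Q) *)
Record ratpoint (d : int) :=
  RatPoint { coords :> option (rat * rat) ; _ : on_curve d coords }.

HB.instance Definition _ (d : int) := [isSub for @coords d].
HB.instance Definition _ (d : int) := [Choice of ratpoint d by <:].

Definition origin (d : int) : ratpoint d := @RatPoint d None isT.

Definition add_point (d : int) (P Q : ratpoint d) : ratpoint d :=
  RatPoint (on_curve_add (valP P) (valP Q)).

Definition mul_point (d : int) (n : nat) (P : ratpoint d) : ratpoint d :=
  iter n (add_point P) (origin d).

Definition torsion (d : int) : set (ratpoint d) :=
  [set P | exists2 n : nat, (0 < n)%N & mul_point n P = origin d].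

(* Coprime homogeneous coordinates of x(P) in P^1(Q), where x = [x : z] has
   value [1 : 0] at the origin. *)
Definition xcoord (d : int) (P : ratpoint d) : int * int :=
  if coords P is Some (x, _) then (numq x, denq x) else (1, 0).

Definition log_height (R : realType) (a : int * int) : R :=
  ln (Num.max `|a.1| `|a.2|)%:~R.

Definition canonical_height (R : realType) (d : int) (P : ratpoint d) : R :=
  2^-1 *
  limn (fun n : nat => (4 ^+ n)^-1 * log_height R (xcoord (mul_point (2 ^ n) P))).

Definition nontorsion_heights (R : realType) (d : int) : set R :=
  [set canonical_height R P | P in ~` @torsion d].

(* The default 0 is not used for d <> 0: by Northcott's theorem a nonempty
   set of heights of non-torsion points has a least element. *)
Definition log_zeta (R : realType) (d : int) : \bar R :=
  if pselect (@nontorsion_heights R d = set0) then +oo%E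
  else (xget 0 [set m | nontorsion_heights d m /\
                        lbound (@nontorsion_heights R d) m])%:E.

Definition zeta (R : realType) (d : int) : \bar R := expeR (log_zeta R d).

Definition large_zeta (R : realType) (eps B : R) : set int :=
  [set d | S6 B d /\
           (((`|d|%:~R : R) `^ (43 / 246 - eps))%:E < zeta R d)%E].

Definition card_set (R : realType) (A : set int) : R := (#|` fset_set A|)%:R.

(* fset_set is the empty set on infinite sets, hence this check. *)
Lemma finite_S6 (R : realType) (B : R) : finite_set (S6 B).
Proof.
apply: (@sub_finite_set _ _
  ((fun n : nat => n%:Z) @` `I_(Num.truncn B).+1 `|`
   (fun n : nat => - n%:Z) @` `I_(Num.truncn B).+1)); last first.
  by rewrite finite_setU; split; exact/finite_image/finite_II.
move=> d [dB _].
have hB : (`|d|%N < (Num.truncn B).+1)%N.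
  have := le_lt_trans dB (truncnS_gt B).
  by rewrite -abszE -[(`|d|%:Z)%:~R]/(`|d|%N%:R) ltr_nat.
case: (intP d) hB => [|n|n] hB.
- by left; exists 0%N.
- by left; exists n.+1.
- by right; exists n.+1 => //=; move: hB; rewrite abszN.
Qed.

(* Main.v *)
Require Import Defs.
From mathcomp Require Import all_boot all_order all_algebra finmap.
From mathcomp Require Import all_classical all_reals all_analysis.
From mathcomp Require Import ring lra zify.
Import Order.TTheory GRing.Theory Num.Theory.
Import numFieldNormedType.Exports.

Local Open Scope classical_set_scope.
Local Open Scope ring_scope.

(** Let [P = (x, y)] be a non-torsion point of [E_d], with [x = a / D] in lowest
    terms and [b] the numerator of [y], so that [b^2 = a^3 + d D^3]. Measure
    [P] by [H(P) = max(|a|^3, |d| D^3)] ([curve_height]), which scales correctly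
    under sextic twists. The duplication formula reads
    [x(2P) = a (a^3 - 8 d D^3) / (4 D b^2)]. Two facts control it.

    - With [u = a^3] and [v = d D^3], the cube of the numerator and [d] times
      the cube of the denominator have absolute values [|u| |u - 8v|^3] and
      [64 |v| |u + v|^3], which are never both small compared with
      [max(|u|, |v|)^4] ([duplication_lower]).
    - The common factor of numerator and denominator divides [36 gcd(a, b)^4],
      and [gcd(a, b)^2] divides [d] ([duplication_common_divisor],
      [dvdz_square_mulr]).

    Hence, if [r^2 | d] forces [|r| <= T], then [H(P)^4 <= (72 T^4)^3 H(2P)],
    and iterating Tate's limit yields
    [hhat(P) >= (log H(P) - log(72 T^4)) / 6] ([canonical_height_lower]).
    The iteration uses that [2 (nP)] is the [2n]-fold sum of [P]
    ([mul_point_double]); for a non-torsion point this follows from the two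
    identities [add_double] and [add_double_sub] in two points, whose
    genericity conditions hold because the multiples of [P] that occur have
    distinct abscissas.

    It remains to see that [H(P)] is large for almost all [d]. Let
    [(t - 1)^200 <= B < t^200]. All but [O(t^199)] integers [d] with
    [|d| <= t^200] satisfy [|d| > t^198], have no square divisor [r^2] with
    [r > t], and have no solution of [b^2 = a^3 + d D^3] in the box
    [|a| <= t^72], [|b| <= 2 t^108], [0 < D <= t^6]: such a solution determines
    [d], and the box has [O(t^186)] elements. For the remaining [d], every
    non-torsion point has [H(P) >= t^216], so [6 hhat(P)] exceeds [210 log t],
    i.e. [hhat(P) > 35 log t]. As [200 * 43 / 246 < 35], this beats
    [(43 / 246) log |d|]. Finally at least half of the integers from [1] to [B] are
    sixth-power free ([card_S6_ge]), so the exceptions have density zero. *)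

(** * Chord and tangent identities *)

Lemma add_chord (x1 y1 x2 y2 : rat) : x1 != x2 ->
  add_coords (Some (x1, y1)) (Some (x2, y2)) =
  let l := (y2 - y1) / (x2 - x1) in
  Some (l ^+ 2 - x1 - x2, l * (x1 - (l ^+ 2 - x1 - x2)) - y1).
Proof. by move=> /negbTE ne; rewrite /add_coords ne. Qed.

Lemma add_tangent (x y : rat) : y != 0 ->
  add_coords (Some (x, y)) (Some (x, y)) =
  let l := 3 * x ^+ 2 / (2 * y) in
  Some (l ^+ 2 - x - x, l * (x - (l ^+ 2 - x - x)) - y).
Proof.
move=> y0; rewrite /add_coords eqxx /=.
suff -> : (y == - y) = false by [].
by apply/negbTE; apply: contra y0; rewrite -subr_eq0 opprK -mulr2n mulrn_eq0.
Qed.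

Lemma add_coordsC (d : int) (P Q : option (rat * rat)) :
  on_curve d P -> on_curve d Q -> add_coords P Q = add_coords Q P.
Proof.
case: P Q => [[x1 y1]|] [[x2 y2]|] //= /eqP h1 /eqP h2.
have [ex|nx] := eqVneq x1 x2 => /=.
  subst x2; rewrite -[y1 == _]eqr_opp opprK [- y1 == _]eq_sym.
  case: (eqVneq y2 (- y1)) => // ny.
  have : (y2 - y1) * (y2 + y1) = 0.
    by transitivity (y2 ^+ 2 - y1 ^+ 2); [ring | rewrite h1 h2; ring].
  move/eqP; rewrite mulf_eq0 subr_eq0 addr_eq0 (negbTE ny) orbF => /eqP ->.
  by [].
have nz : x2 - x1 != 0 by rewrite subr_eq0 eq_sym.
have nz' : x1 - x2 != 0 by rewrite subr_eq0.
by congr (Some (_, _)); field; rewrite nz nz'.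
Qed.

Definition opp_coords (P : option (rat * rat)) : option (rat * rat) :=
  omap (fun p => (p.1, - p.2)) P.

Lemma opp_coordsE x y : opp_coords (Some (x, y)) = Some (x, - y).
Proof. by []. Qed.

Lemma opp_coordsK : involutive opp_coords.
Proof. by case=> [[x y]|] //=; rewrite opprK. Qed.

Lemma on_curve_opp d P : on_curve d (opp_coords P) = on_curve d P.
Proof. by case: P => [[x y]|] //=; rewrite sqrrN. Qed.

Lemma opp_coordsD P Q :
  opp_coords (add_coords P Q) = add_coords (opp_coords P) (opp_coords Q).
Proof.
case: P Q => [[x1 y1]|] [[x2 y2]|] //=.
rewrite eqr_opp; case: ifP => //= _.
have -> : (if x1 == x2 then 3 * x1 ^+ 2 / (2 * - y1) else (- y2 - - y1) / (x2 - x1))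
   = - (if x1 == x2 then 3 * x1 ^+ 2 / (2 * y1) else (y2 - y1) / (x2 - x1)).
  by case: ifP => _; [rewrite mulrN invrN mulrN | rewrite -opprD mulNr].
set l := (if _ then _ else _); by congr (Some (_, _)); ring.
Qed.

(** The chord through two points is described by its slope [l] and the two
    abscissas, both ordinates being rational functions of these. This removes
    the curve equation, so that identities between points become identities
    of rational functions. A zero slope would give [u^2 + u x + x^2 = 0], which
    has no nontrivial rational solution. *)
Lemma chord_param (c x y u v : rat) :
    y ^+ 2 = x ^+ 3 + c -> v ^+ 2 = u ^+ 3 + c -> u != x ->
  exists l, [/\ l != 0, v = y + l * (u - x) &
    y = (u ^+ 2 + (x - l ^+ 2) * u + x ^+ 2 + l ^+ 2 * x) / (2 * l)].
Proof.
move=> hy hv ux; have nz : u - x != 0 by rewrite subr_eq0.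
exists ((v - y) / (u - x)); set l := _ / _.
have lE : v = y + l * (u - x) by rewrite /l divfK // subrKC.
have h : u ^+ 2 + (x - l ^+ 2) * u + x ^+ 2 + l ^+ 2 * x = y * (2 * l).
  apply: (mulIf nz); transitivity (u ^+ 3 - x ^+ 3 - l ^+ 2 * (u - x) ^+ 2).
    by ring.
  have -> : u ^+ 3 - x ^+ 3 = v ^+ 2 - y ^+ 2 by rewrite hy hv; ring.
  by rewrite lE; ring.
have l0 : l != 0.
  apply/eqP => l0; move: h; rewrite l0 => h.
  have h2 : (u + x / 2) ^+ 2 + 3 * (x / 2) ^+ 2 = 0.
    by transitivity (u ^+ 2 + (x - 0 ^+ 2) * u + x ^+ 2 + 0 ^+ 2 * x);
      [field | rewrite h !mulr0].
  have x0 : x = 0.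
    have : x ^+ 2 == 0.
      rewrite eq_le sqr_ge0 andbT.
      by move: h2 (sqr_ge0 (u + x / 2)); rewrite exprMn; lra.
    by rewrite expf_eq0 => /eqP.
  have u0 : u ^+ 2 = 0 by rewrite -h2 x0; ring.
  by move/eqP: u0 ux; rewrite expf_eq0 x0 /= => ->.
split=> //; rewrite h mulfK // mulf_neq0 //.
Qed.

Arguments add_coords : simpl never.

Section Identities.
Variables (d : int) (x y u v : rat).
Hypotheses (hB : on_curve d (Some (x, y))) (hA : on_curve d (Some (u, v))).
Let A := Some (u, v).
Let B := Some (x, y).

Lemma add_sub_chord w z : u != x -> add_coords A B = Some (w, z) -> w != u ->
  add_coords (opp_coords A) (add_coords A B) = B.
Proof.
rewrite /A /B opp_coordsE => ux E wu.
have [l [l0 vE yE]] := chord_param _ _ _ _ _ (eqP hB) (eqP hA) ux.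
have xu0 : x - u != 0 by rewrite subr_eq0 eq_sym.
have lE : (y - v) / (x - u) = l by rewrite vE; field.
move: E wu; rewrite add_chord //= lE => -[<- _] wu.
rewrite add_chord 1?eq_sym //=.
have wu0 : l ^+ 2 - u - x - u != 0 by rewrite subr_eq0.
have -> : (l * (u - (l ^+ 2 - u - x)) - v - - v) / (l ^+ 2 - u - x - u) = - l.
  by field.
by congr (Some (_, _)); rewrite ?vE; ring.
Qed.

Lemma add_sub_tangent w z : v != 0 -> add_coords A A = Some (w, z) -> w != u ->
  add_coords (opp_coords A) (add_coords A A) = A.
Proof.
rewrite /A /B opp_coordsE => v0; rewrite add_tangent //=; set l := _ / _ => -[<- _] wu.
rewrite add_chord 1?eq_sym //=.
have wu0 : l ^+ 2 - u - u - u != 0 by rewrite subr_eq0.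
have -> : (l * (u - (l ^+ 2 - u - u)) - v - - v) / (l ^+ 2 - u - u - u) = - l.
  by field.
by congr (Some (_, _)); ring.
Qed.

(** With [A = P] and [B = nP], this turns the known double of [B] into the sum
    of two consecutive multiples of [P]. *)
Lemma add_double w z p r : u != x -> y != 0 ->
    add_coords A B = Some (w, z) -> w != x ->
    add_coords B B = Some (p, r) -> p != u ->
  add_coords B (add_coords A B) = add_coords A (add_coords B B).
Proof.
move=> ux y0 E wx F pu.
have [l [l0 vE yE]] := chord_param _ _ _ _ _ (eqP hB) (eqP hA) ux.
have xu0 : x - u != 0 by rewrite subr_eq0 eq_sym.
have lE : (y - v) / (x - u) = l by rewrite vE; field.
move: E wx F pu; rewrite add_tangent // add_chord //= lE => -[<- _] wx [<- _] pu.
rewrite add_chord 1?eq_sym //= add_chord 1?eq_sym //=.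
set q := (X in y = X / _) in yE.
have q0 : q != 0 by apply: contra y0; rewrite yE => /eqP ->; rewrite mul0r.
have wx0 : l ^+ 2 - u - x - x != 0 by rewrite subr_eq0.
have pu0 : (3 * x ^+ 2 / (2 * y)) ^+ 2 - x - x - u != 0 by rewrite subr_eq0.
have pu1 : (3 * x ^+ 2 * l) ^+ 2 - (2 * x + u) * q ^+ 2 != 0.
  apply: contra pu0 => /eqP h; apply/eqP.
  transitivity (((3 * x ^+ 2 * l) ^+ 2 - (2 * x + u) * q ^+ 2) / q ^+ 2).
    by rewrite yE; field; rewrite q0 l0.
  by rewrite h mul0r.
congr (Some (_, _)); rewrite vE yE; move: q0 wx0 pu1; rewrite /q => q0 wx0 pu1.
  field; rewrite l0 q0 wx0 andbT /=.
  by apply: contra pu1 => /eqP h; apply/eqP; rewrite -h; ring.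
field; rewrite l0 q0 wx0 andbT /=.
by apply: contra pu1 => /eqP h; apply/eqP; rewrite -h; ring.
Qed.

(** No condition is put on the abscissa of the double itself, which can thus be
    computed from sums that are already known. *)
Lemma add_double_sub w z p r : u != x -> y != 0 ->
    add_coords (opp_coords A) B = Some (w, z) -> w != x ->
    add_coords B (add_coords (opp_coords A) B) = Some (p, r) -> p != u ->
  add_coords A (add_coords B (add_coords (opp_coords A) B)) = add_coords B B.
Proof.
rewrite /A /B opp_coordsE => ux y0 E wx F pu.
have hA' : (- v) ^+ 2 = u ^+ 3 + d%:~R by rewrite sqrrN; exact: eqP hA.
have [l [l0 vE yE]] := chord_param _ _ _ _ _ (eqP hB) hA' ux.
have xu0 : x - u != 0 by rewrite subr_eq0 eq_sym.
have lE : (y - - v) / (x - u) = l by rewrite vE; field.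
move: F E wx pu; rewrite add_tangent // add_chord //= lE.
move=> F [wE _]; rewrite -wE => wx.
have wx0 : l ^+ 2 - u - x - x != 0 by rewrite subr_eq0.
move: F; rewrite add_chord /=; last by rewrite eq_sym.
set q := (X in y = X / _) in yE.
have q0 : q != 0 by apply: contra y0; rewrite yE => /eqP ->; rewrite mul0r.
set e := l ^+ 2 - u - x - x in wx0 *.
have vE' : v = - (y + l * (u - x)) by rewrite -vE opprK.
set l2 := (X in X ^+ 2).
have l2E : l2 = - (q + l ^+ 2 * e) / (l * e).
  by rewrite /l2 vE' yE; move: wx0; rewrite /q /e => wx0; field; rewrite l0 wx0.
move=> [<- _] pu; rewrite add_chord /=; last by rewrite eq_sym.
have pu0 : l2 ^+ 2 - x - (l ^+ 2 - u - x) - u != 0 by rewrite subr_eq0.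
have pu1 : q + 2 * l ^+ 2 * e != 0.
  apply: contra pu0 => /eqP h; apply/eqP.
  (* a difference of two squares, as [x + w + u = l ^+ 2] for the chord *)
  transitivity (q * (q + 2 * l ^+ 2 * e) / (l * e) ^+ 2).
    by rewrite l2E; field; rewrite l0 wx0.
  by rewrite h mulr0 mul0r.
have pu2 : q * (q + 2 * l ^+ 2 * e) != 0 by rewrite mulf_neq0.
congr (Some (_, _)); rewrite l2E vE' yE; move: q0 wx0 pu2; rewrite /e /q => q0 wx0 pu2.
  field; rewrite l0 q0 wx0 /=.
  by apply: contra pu2 => /eqP h; apply/eqP; rewrite -h; ring.
field; rewrite l0 q0 wx0 /=.
by apply: contra pu2 => /eqP h; apply/eqP; rewrite -h; ring.
Qed.
End Identities.

(** * Multiples of a non-torsion point *)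

Lemma add_opp_coords P : add_coords P (opp_coords P) = None.
Proof. by case: P => [[x y]|] //; rewrite /add_coords /= eqxx opprK eqxx. Qed.

(** If [P + Q = P] with [Q] affine, the line through [P] and [Q] contains [-P];
    unless [P] is its own opposite, that line is vertical, and then [P + Q] is
    the origin. *)
Lemma add_coords_eq_left x y Q :
  y != 0 -> add_coords (Some (x, y)) Q = Some (x, y) -> Q = None.
Proof.
move=> y0; case: Q => [[u v]|] //; rewrite /add_coords; case: ifP => // _.
set l := (if _ then _ else _) => -[-> yE]; move: y0.
have -> : y = 0 by move: yE; rewrite subrr mulr0; lra.
by rewrite eqxx.
Qed.

Lemma same_abscissa d x y v : on_curve d (Some (x, y)) -> on_curve d (Some (x, v)) ->
  v = y \/ v = - y.
Proof.
move=> /eqP hy /eqP hv; have /eqP : v ^+ 2 = y ^+ 2 by rewrite hy hv.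
by rewrite eqf_sqr => /orP[] /eqP; [left | right].
Qed.

Section Multiples.
Variables (d : int) (P : ratpoint d).
Hypothesis nt : ~ torsion P.
Let Q n := coords (mul_point n P).

Let Qc n : on_curve d (Q n). Proof. exact: valP. Qed.

Let QS n : Q n.+1 = add_coords (Q 1) (Q n).
Proof. by rewrite /Q /mul_point iterS /=; case: (coords P) => [[]|]. Qed.

Let Q_neq0 n : (0 < n)%N -> Q n <> None.
Proof.
move=> n0 Qn; apply: nt; exists n => //; apply: val_inj; exact: Qn.
Qed.

Let Q_Some n : (0 < n)%N -> exists p, Q n = Some p.
Proof. by move=> n0; case: (Q n) (Q_neq0 n n0) => [p|//] _; exists p. Qed.

Let Q_ord1 x y : Q 1 = Some (x, y) -> y != 0.
Proof.
move=> Q1; apply/eqP => y0; apply: (@Q_neq0 2) => //.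
by rewrite QS Q1 y0 -{2}oppr0 -opp_coordsE add_opp_coords.
Qed.

Let Q_neq1 n : (1 < n)%N -> Q n <> Q 1.
Proof.
case: n => [|[|n]] // _; have [[x y] Q1] := Q_Some 1 isT.
rewrite QS Q1 => /add_coords_eq_left => /(_ (Q_ord1 _ _ Q1)).
exact: Q_neq0.
Qed.

Let Q_neqN1 n : Q n <> opp_coords (Q 1).
Proof.
by move=> Qn; apply: (@Q_neq0 n.+1) => //; rewrite QS Qn add_opp_coords.
Qed.

Let Q_absc1 n x y u v :
  (1 < n)%N -> Q n = Some (x, y) -> Q 1 = Some (u, v) -> x != u.
Proof.
move=> n1 Qn Q1; apply/eqP => xu; subst x.
have := Qc n; rewrite Qn => h; have := Qc 1; rewrite Q1 => h1.
have [yv|yv] := same_abscissa _ _ _ _ h1 h.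
- by apply: (Q_neq1 n) => //; rewrite Qn Q1 yv.
- by apply: (Q_neqN1 n); rewrite Qn Q1 yv.
Qed.

Let Q_sub n : add_coords (opp_coords (Q 1)) (Q n.+1) = Q n.
Proof.
have h1 := Qc 1; have [[u v] Q1] := Q_Some 1 isT.
case: n => [|[|n]].
- rewrite (@add_coordsC d) ?on_curve_opp ?add_opp_coords //.
- have [[w z] Q2] := Q_Some 2 isT; rewrite (QS 1); rewrite Q1 in h1 *.
  apply: (@add_sub_tangent u v w z); first exact: Q_ord1 Q1.
    by rewrite -Q1 -(QS 1).
  exact: Q_absc1 Q2 Q1.
- have [[w z] Q3] := Q_Some n.+3 isT; have [[x y] Q2] := Q_Some n.+2 isT.
  have h2 := Qc n.+2; rewrite (QS n.+2); rewrite Q1 Q2 in h1 h2 *.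
  apply: (@add_sub_chord d x y u v h2 h1 w z).
  + by rewrite eq_sym; apply: Q_absc1 Q2 Q1.
  + by rewrite -Q1 -Q2 -(QS n.+2).
  + exact: Q_absc1 Q3 Q1.
Qed.

(** Adding [P] to both sides turns [nP = -mP] into [(n+1)P = -(m-1)P]. *)
Let Q_opp m n : Q n = opp_coords (Q m) -> Q (n + m) = None.
Proof.
elim: m n => [|m IH] n Qn; first by rewrite addn0 Qn.
rewrite addnS -addSn; apply: IH.
by rewrite QS Qn -[X in add_coords X _]opp_coordsK -opp_coordsD Q_sub.
Qed.

Let Q_ord n x y : (0 < n)%N -> Q n = Some (x, y) -> y != 0.
Proof.
move=> n0 Qn; apply/eqP => y0; apply: (@Q_neq0 (n + n)); first by lia.
by apply: Q_opp; rewrite Qn opp_coordsE y0 oppr0.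
Qed.

Let Q_abscS n x y w z :
  (0 < n)%N -> Q n = Some (x, y) -> Q n.+1 = Some (w, z) -> w != x.
Proof.
move=> n0 Qn QSn; apply/eqP => wx; subst w.
have := Qc n; rewrite Qn => h; have := Qc n.+1; rewrite QSn => h1.
have [yv|yv] := same_abscissa _ _ _ _ h h1.
- apply: (@Q_neq0 1) => //; apply: (@add_coords_eq_left x y).
    exact: Q_ord Qn.
  by rewrite -Qn (@add_coordsC d) // -QS QSn yv Qn.
- apply: (@Q_neq0 (n.+1 + n)) => //; apply: Q_opp.
  by rewrite QSn Qn yv.
Qed.

(** [2(nP)] and [nP + (n+1)P] are treated together: knowing
    [nP + (n+1)P = (2n+1)P], [add_double_sub] gives [2((n+1)P) = (2n+2)P], and
    then [add_double] gives [(n+1)P + (n+2)P = (2n+3)P]. *)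
Lemma mul_point_double n : (0 < n)%N ->
  coords (mul_point n.*2 P) = add_coords (coords (mul_point n P)) (coords (mul_point n P)).
Proof.
suff : (0 < n)%N -> Q n.*2 = add_coords (Q n) (Q n) /\
   Q n.*2.+1 = add_coords (Q n) (Q n.+1) by move=> h n0; case: (h n0).
elim: n => [|[|n] IH] // _; first by split; [exact: (QS 1) | exact: (QS 2)].
have {IH} [_ IH2] := IH isT.
have [[u v] Q1] := Q_Some 1 isT.
have [[x y] Q2] := Q_Some n.+2 isT.
have [[w z] Q3] := Q_Some n.+1 isT.
have [[w' z'] Q4] := Q_Some n.+3 isT.
have [[p r] Q5] := Q_Some n.+1.*2.+1 isT.
have [[p' r'] Q6] := Q_Some n.+2.*2 isT.
have ux : u != x by rewrite eq_sym; apply: Q_absc1 Q2 Q1.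
have y0 : y != 0 by exact: Q_ord Q2.
have hB := Qc n.+2; have hA := Qc 1; rewrite Q2 in hB; rewrite Q1 in hA.
have E : Q n.+2.*2 = add_coords (Q n.+2) (Q n.+2).
  have e2 : add_coords (Q n.+2) (add_coords (opp_coords (Q 1)) (Q n.+2)) = Q n.+1.*2.+1.
    by rewrite Q_sub IH2; apply: (@add_coordsC d).
  rewrite doubleS (QS n.+1.*2.+1) -e2 Q1 Q2.
  apply: (@add_double_sub d x y u v hB hA w z p r) => //.
  - by rewrite -Q1 -Q2 Q_sub.
  - by rewrite eq_sym; apply: Q_abscS Q3 Q2.
  - by rewrite -Q1 -Q2 e2.
  - by apply: Q_absc1 Q5 Q1; rewrite doubleS.
split=> //.
rewrite (QS n.+2.*2) E (QS n.+2) Q1 Q2; apply/esym.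
apply: (@add_double d x y u v hB hA w' z' p' r') => //.
- by rewrite -Q1 -Q2 -(QS n.+2).
- exact: Q_abscS Q2 Q4.
- by rewrite -Q2 -E.
- by apply: Q_absc1 Q6 Q1; rewrite doubleS.
Qed.

Lemma nontorsion_mul_Some n : (0 < n)%N -> exists x y,
  coords (mul_point n P) = Some (x, y) /\ y != 0.
Proof.
by move=> n0; have [[x y] Qn] := Q_Some n n0; exists x, y; split=> //; apply: Q_ord Qn.
Qed.
End Multiples.

(** * The duplication formula in integral coordinates *)

(** A common divisor of the numerators of both coordinates contributes a square
    factor of [d]; this is how bad reduction of a point is charged to [d]. *)
Lemma dvdz_square_mulr (m d D a b : int) :
  b ^+ 2 = a ^+ 3 + d * D ^+ 3 -> (m %| a)%Z -> (m %| b)%Z -> coprimez m D ->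
  (m ^+ 2 %| d)%Z.
Proof.
move=> h ma mb co.
have : (m ^+ 2 %| d * D ^+ 3)%Z.
  have -> : d * D ^+ 3 = b ^+ 2 - a ^+ 3 by rewrite h; ring.
  by rewrite rpredB // ?dvdz_exp2r // exprSr dvdz_mulr // dvdz_exp2r.
by rewrite Gauss_dvdzl // coprimezXl // coprimezXr.
Qed.

(** Write [a = a' m], [b = b' m] with [m = gcd(a, b)]. A common divisor [g] of
    numerator and denominator is prime to [D], hence divides [4 b^2]; combining
    this with the numerator, it divides both [36 m^4 b'^2] and [36 m^4 a'^4]. *)
Lemma duplication_common_divisor (a b d D g : int) :
  b ^+ 2 = a ^+ 3 + d * D ^+ 3 -> b != 0 -> coprimez a D ->
  (g %| a * (a ^+ 3 - 8 * (d * D ^+ 3)))%Z -> (g %| 4 * D * b ^+ 2)%Z ->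
  (g %| 36 * gcdz a b ^+ 4)%Z.
Proof.
move=> h b0 co gN gM; set m := gcdz a b.
have m0 : m != 0 by rewrite gcdz_eq0 negb_and b0 orbT.
have ma : (m %| a)%Z by exact: dvdz_gcdl.
have mb : (m %| b)%Z by exact: dvdz_gcdr.
case/dvdzP: (ma) => a' aE; case/dvdzP: (mb) => b' bE.
have co' : coprimez a' b'.
  have e : gcdz a' b' * `|m| = m by rewrite -abszE mulz_gcdl -aE -bE.
  by rewrite ger0_norm // in e; apply/eqP/(mulIf m0); rewrite mul1r.
have gD : coprimez g D.
  have : coprimez (a * (a ^+ 3 - 8 * (d * D ^+ 3))) D.
    rewrite coprimezMl co /=.
    have -> : a ^+ 3 - 8 * (d * D ^+ 3) = a ^+ 3 + (- 8 * d * D ^+ 2) * D by ring.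
    by rewrite coprimez_sym /coprimez addrC gcdzMDl -/(coprimez D _) coprimez_sym coprimezXl.
  by apply: coprimez_dvdl.
have g1 : (g %| 4 * b ^+ 2)%Z.
  by rewrite -(Gauss_dvdzl _ gD) (_ : 4 * b ^+ 2 * D = 4 * D * b ^+ 2) //; ring.
have g2 : (g %| 36 * m ^+ 4 * b' ^+ 2)%Z.
  have -> : 36 * m ^+ 4 * b' ^+ 2 = 4 * b ^+ 2 * (9 * m ^+ 2) by rewrite bE; ring.
  exact: dvdz_mulr.
have g3 : (g %| 36 * m ^+ 4 * a' ^+ 4)%Z.
  have -> : 36 * m ^+ 4 * a' ^+ 4 =
     a * (a ^+ 3 - 8 * (d * D ^+ 3)) * 4 + 4 * b ^+ 2 * (8 * a).
    have -> : d * D ^+ 3 = b ^+ 2 - a ^+ 3 by rewrite h; ring.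
    by rewrite aE; ring.
  by rewrite rpredD // dvdz_mulr.
have : (g %| gcdz (36 * m ^+ 4 * b' ^+ 2) (36 * m ^+ 4 * a' ^+ 4))%Z.
  by rewrite dvdz_gcd g2 g3.
rewrite -mulz_gcdr.
have /eqP -> : coprimez (b' ^+ 2) (a' ^+ 4).
  by rewrite coprimezXl // coprimezXr // coprimez_sym.
by rewrite mulr1 dvdzE absz_nat -dvdzE.
Qed.

(** Both sides of [y^2 = x^3 + d] are reduced fractions once written with the
    numerators and denominators of [x] and [y], so these can be compared. *)
Lemma rat_curve_reduced (d : int) (x y : rat) : on_curve d (Some (x, y)) ->
  numq y ^+ 2 = numq x ^+ 3 + d * denq x ^+ 3 /\ denq y ^+ 2 = denq x ^+ 3.
Proof.
move=> /eqP h.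
set a := numq x; set D := denq x; set b := numq y; set m := denq y.
have D0 : D%:~R != 0 :> rat by rewrite intr_eq0 denq_eq0.
have m0 : m%:~R != 0 :> rat by rewrite intr_eq0 denq_eq0.
have xE : x = a%:~R / D%:~R by rewrite divq_num_den.
have yE : y = b%:~R / m%:~R by rewrite divq_num_den.
have co1 : coprimez (b ^+ 2) (m ^+ 2).
  by apply: coprimezXl; apply: coprimezXr; exact: coprime_num_den.
have co2 : coprimez (a ^+ 3 + d * D ^+ 3) (D ^+ 3).
  rewrite coprimez_sym /coprimez addrC gcdzMDl -/(coprimez _ _) coprimez_sym; apply: coprimezXl;
    by apply: coprimezXr; exact: coprime_num_den.
have e1 : y ^+ 2 = (b ^+ 2)%:~R / (m ^+ 2)%:~R.
  by rewrite yE !rmorphXn /= expr_div_n.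
have e2 : y ^+ 2 = (a ^+ 3 + d * D ^+ 3)%:~R / (D ^+ 3)%:~R.
  by rewrite h rmorphD rmorphM !rmorphXn /= xE; field.
split.
  have := coprimeq_num co1; rewrite -e1 e2 (coprimeq_num co2).
  by rewrite !gtr0_sg ?mul1r // exprn_gt0 // denq_gt0.
have := coprimeq_den co1; rewrite -e1 e2 (coprimeq_den co2).
by rewrite !expf_eq0 /= !denq_eq0 !gtr0_norm // exprn_gt0 // denq_gt0.
Qed.

Lemma duplication_abscissa (d : int) (x y : rat) :
  on_curve d (Some (x, y)) -> y != 0 ->
  let a := numq x in let D := denq x in
  exists2 z, add_coords (Some (x, y)) (Some (x, y)) = Some z &
    z.1 = (a * (a ^+ 3 - 8 * (d * D ^+ 3)))%:~R / (4 * D * numq y ^+ 2)%:~R.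
Proof.
move=> hc y0 a D; rewrite add_tangent //; eexists; first by [].
have [hi _] := rat_curve_reduced _ _ _ hc; rewrite -/a -/D in hi.
move/eqP: hc => h.
have D0 : D%:~R != 0 :> rat by rewrite intr_eq0 denq_eq0.
have xE : x = a%:~R / D%:~R by rewrite divq_num_den.
have y2E : y ^+ 2 = (numq y ^+ 2)%:~R / D%:~R ^+ 3.
  by rewrite hi h rmorphD rmorphM !rmorphXn /= xE; field.
have b0 : (numq y)%:~R != 0 :> rat by rewrite intr_eq0 numq_eq0.
have E : x ^+ 3 + d%:~R = (numq y)%:~R ^+ 2 / D%:~R ^+ 3 by rewrite -h y2E rmorphXn.
rewrite /=; transitivity (x * (x ^+ 3 - 8 * d%:~R) / (4 * y ^+ 2)).
  have -> : d%:~R = y ^+ 2 - x ^+ 3 by rewrite h; ring.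
  by field.
rewrite y2E !(rmorphM, rmorphXn, rmorphB) /= ?rmorphXn /= xE.
by field; rewrite D0 b0.
Qed.

(** * Tate's limit *)

Section TateLimit.
Variables (R : realType) (h m : nat -> R) (K c C : R).
Hypotheses (h1 : forall n, 1 <= h n) (m1 : forall n, 1 <= m n) (K1 : 1 <= K) (c1 : 1 <= c) (C1 : 1 <= C).
Hypothesis h_lower : forall n, h n ^+ 4 <= K ^+ 3 * h n.+1.
Hypothesis h_upper : forall n, h n.+1 <= C * h n ^+ 4.
Hypothesis mh : forall n, m n ^+ 3 <= h n.
Hypothesis hm : forall n, h n <= c * m n ^+ 3.

(** The sequence [4^-n (ln (h n) - ln K)] is nondecreasing, so its limit is at
    least its first term, and [4^-n (ln (h n) + ln C)] is nonincreasing, which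
    bounds it and makes it converge. The bounds relating [m^3] to [h] show that
    [ln m] has a third of the same limit. *)
Lemma tate_limit_lower :
  (ln (h 0) - ln K) / 3 <= limn (fun n => (4 ^+ n)^-1 * ln (m n)).
Proof.
have h0 n : 0 < h n by apply: lt_le_trans (h1 n).
have m0 n : 0 < m n by apply: lt_le_trans (m1 n).
have K0 : 0 < K by apply: lt_le_trans K1.
have c0 : 0 < c by apply: lt_le_trans c1.
have C0 : 0 < C by apply: lt_le_trans C1.
have p4 n : 0 < (4 : R) ^+ n by rewrite exprn_gt0.
have lnX (x : R) n : 0 < x -> ln (x ^+ n) = n%:R * ln x.
  by move=> x0; rewrite lnXn // mulr_natl.
pose s n := (4 ^+ n)^-1 * (ln (h n) - ln K).
have lnK : 0 <= ln K by rewrite ln_ge0.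
have lnC : 0 <= ln C by rewrite ln_ge0.
have s_nd : nondecreasing_seq s.
  apply/nondecreasing_seqP => n; rewrite /s exprSr invfM -mulrA ler_pM2l ?invr_gt0 //.
  have := h_lower n; rewrite -ler_ln ?posrE ?mulr_gt0 ?exprn_gt0 //.
  rewrite lnM ?posrE ?exprn_gt0 // !lnX // => e.
  by rewrite ler_pdivlMl //; lra.
have s_ub n : s n <= (4 ^+ n)^-1 * (ln (h n) + ln C).
  by rewrite ler_pM2l ?invr_gt0 //; lra.
have t_ub n : (4 ^+ n)^-1 * (ln (h n) + ln C) <= ln (h 0) + ln C.
  elim: n => [|n IH]; first by rewrite expr0 invr1 mul1r.
  apply: le_trans IH; rewrite exprSr invfM -mulrA ler_pM2l ?invr_gt0 //.
  have := h_upper n; rewrite -ler_ln ?posrE ?mulr_gt0 ?exprn_gt0 //.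
  rewrite lnM ?posrE ?exprn_gt0 // !lnX // => e.
  by rewrite ler_pdivrMl //; lra.
have s_cvg : cvgn s.
  apply: nondecreasing_is_cvgn => //; exists (ln (h 0) + ln C) => _ [n _ <-].
  exact: le_trans (s_ub n) (t_ub n).
have e_bound n : `|ln (m n) - (ln (h n) - ln K) / 3| <= ln c + ln K.
  have := mh n; rewrite -ler_ln ?posrE ?mulr_gt0 ?exprn_gt0 // lnX // => e1.
  have := hm n; rewrite -ler_ln ?posrE ?mulr_gt0 ?exprn_gt0 //.
  rewrite lnM ?posrE ?exprn_gt0 // !lnX // => e2.
  have lnc : 0 <= ln c by rewrite ln_ge0.
  by rewrite ler_norml; apply/andP; split; lra.
pose e n := (4 ^+ n)^-1 * (ln (m n) - (ln (h n) - ln K) / 3).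
have g0 : (fun n => (4 ^+ n)^-1 * (ln c + ln K)) @ \oo --> (0 : R).
  rewrite -[X in _ --> X](mul0r (ln c + ln K)); apply: cvgMr_tmp.
  have := @cvg_expr R 4^-1; rewrite ger0_norm ?invr_ge0 // => /(_ _).
  under [X in _ -> X]eq_cvg do rewrite -exprVn.
  by apply; rewrite invf_lt1 // ltr1n.
have e_cvg : e @ \oo --> (0 : R).
  apply: norm_cvg0; apply: (squeeze_cvgr _ (cvg_cst 0) g0).
  apply/nearW => n /=; rewrite normr_ge0 /= /e normrM ger0_norm ?invr_ge0 ?(ltW (p4 n)) //.
  by rewrite ler_pM2l ?invr_gt0 //; exact: e_bound.
have -> : (fun n => (4 ^+ n)^-1 * ln (m n)) = (fun n => s n / 3 + e n).
  by apply/funext => n; rewrite /s /e; ring.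
have cv : (fun n => s n / 3 + e n) @ \oo --> limn s / 3 + 0.
  by apply: cvgD => //; apply: cvgMr_tmp.
rewrite (cvg_lim _ cv) // addr0.
rewrite ler_pM2r ?invr_gt0 //.
have -> : ln (h 0) - ln K = s 0%N by rewrite /s expr0 invr1 mul1r.
exact: nondecreasing_cvgn_le.
Qed.
End TateLimit.

(** * Growth of heights under duplication *)

Lemma ler_mul_cube (M X Y p q : int) : 0 <= M -> M <= p * X -> M <= q * Y ->
  0 <= q -> 0 <= Y -> M ^+ 4 <= p * q ^+ 3 * (X * Y ^+ 3).
Proof.
move=> M0 hX hY q0 Y0; rewrite exprS mulrACA -exprMn.
by apply: ler_pM => //; rewrite ?exprn_ge0 // lerXn2r // nnegrE ?mulr_ge0.
Qed.

(** If [|u| >= |v|] and [u - 8v] is small, then [v] is about [u / 8], so [v] and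
    [u + v] are comparable with [u]. If [|v| > |u|] and [u + v] is small, then
    [u] is about [-v], so [u] and [u - 8v] are comparable with [v]. *)
Lemma duplication_lower (u v : int) :
  Num.max `|u| `|v| ^+ 4 <=
  8 * Num.max (`|u| * `|u - 8 * v| ^+ 3) (64 * (`|v| * `|u + v| ^+ 3)).
Proof.
set N := Num.max _ (_ * _).
have N1 : `|u| * `|u - 8 * v| ^+ 3 <= N by rewrite le_max lexx.
have N2 : 64 * (`|v| * `|u + v| ^+ 3) <= N by rewrite le_max lexx orbT.
have n1 : 0 <= `|u| * `|u - 8 * v| ^+ 3 by rewrite mulr_ge0 ?exprn_ge0.
have n2 : 0 <= `|v| * `|u + v| ^+ 3 by rewrite mulr_ge0 ?exprn_ge0.
case: (leP `|v| `|u|) => uv; [case: (leP `|u| (2 * `|u - 8 * v|)) => w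
  | case: (leP `|v| (2 * `|u + v|)) => w].
- by refine (le_trans (@ler_mul_cube _ `|u| `|(u - 8 * v)| 1 2 _ _ _ _ _) _);
     first [exact: normr_ge0 | done | lra | lia].
- by refine (le_trans (@ler_mul_cube _ `|v| `|(u + v)| 16 1 _ _ _ _ _) _);
     first [exact: normr_ge0 | done | lra | lia].
- by refine (le_trans (@ler_mul_cube _ `|v| `|(u + v)| 1 2 _ _ _ _ _) _);
     first [exact: normr_ge0 | done | lra | lia].
- by refine (le_trans (@ler_mul_cube _ `|u| `|(u - 8 * v)| 2 1 _ _ _ _ _) _);
     first [exact: normr_ge0 | done | lra | lia].
Qed.

(** [729 = 9^3], because [|u - 8v| <= 9 max(|u|, |v|)]. *)
Lemma duplication_upper (u v : int) :
  Num.max (`|u| * `|u - 8 * v| ^+ 3) (64 * (`|v| * `|u + v| ^+ 3)) <=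
  729 * Num.max `|u| `|v| ^+ 4.
Proof.
set M := Num.max `|u| `|v|.
have M1 : `|u| <= M by rewrite le_max lexx.
have M2 : `|v| <= M by rewrite le_max lexx orbT.
have M0 : 0 <= M by apply: le_trans M1.
have f X Y : X <= M -> Y <= 9 * M -> 0 <= X -> 0 <= Y -> X * Y ^+ 3 <= 729 * M ^+ 4.
  move=> XM YM X0 Y0; have -> : 729 * M ^+ 4 = M * (9 * M) ^+ 3 by ring.
  apply: ler_pM => //; rewrite ?exprn_ge0 // lerXn2r ?nnegrE //; lia.
rewrite ge_max f //; try lia.
have -> : 64 * (`|v| * `|u + v| ^+ 3) = `|v| * (4 * `|u + v|) ^+ 3 by ring.
apply: f => //; lia.
Qed.

(** The cube of the naive height of [x], with a weight [|d|] on the denominator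
    that makes it compatible with the twist [x = |d|^(1/3) x'] onto
    [y^2 = x^3 + 1] or [y^2 = x^3 - 1], so that the constants below do not
    depend on [d]. *)
Definition curve_height (d : int) (x : rat) : int :=
  Num.max (`|numq x| ^+ 3) (`|d| * denq x ^+ 3).

Lemma curve_height_ge1 d x : d != 0 -> 1 <= curve_height d x.
Proof.
move=> d0; rewrite le_max; apply/orP; right.
by rewrite -gtz0_ge1 mulr_gt0 ?normr_gt0 // exprn_gt0 // denq_gt0.
Qed.

(** The factor [k] cancelled from the duplication formula satisfies
    [|k| <= 36 T^4], and [8 * 36^3 = 72^3]. *)
Lemma curve_height_double (d T : int) (x y : rat) :
    on_curve d (Some (x, y)) -> y != 0 -> d != 0 ->
    (forall r : int, (r ^+ 2 %| d)%Z -> `|r| <= T) ->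
  exists z, [/\ add_coords (Some (x, y)) (Some (x, y)) = Some z,
    curve_height d x ^+ 4 <= (72 * T ^+ 4) ^+ 3 * curve_height d z.1 &
    curve_height d z.1 <= 729 * curve_height d x ^+ 4].
Proof.
move=> hc y0 d0 hT.
have [z zE xE] := duplication_abscissa _ _ _ hc y0.
have [h _] := rat_curve_reduced _ _ _ hc.
exists z; rewrite zE /curve_height.
set a := numq x in h xE *; set D := denq x in h xE *; set b := numq y in h xE *.
have D0 : 0 < D by exact: denq_gt0.
have b0 : b != 0 by rewrite numq_eq0.
have M0 : 4 * D * b ^+ 2 != 0 by rewrite !mulf_neq0 ?expf_neq0 // gt_eqF.
have coaD : coprimez a D by exact: coprime_num_den.
have gk := duplication_common_divisor a b d D.
set N := a * _ in xE gk; set M := 4 * D * _ in xE gk M0.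
have [k [k0 NE ME]] : exists k : int, [/\ k != 0, N = k * numq z.1 & M = k * denq z.1].
  rewrite xE; case: divqP => [M0'|k q k0]; first by rewrite M0' eqxx in M0.
  by exists k.
have kT : `|k| <= 36 * T ^+ 4.
  have kdiv : (k %| 36 * gcdz a b ^+ 4)%Z.
    by apply: gk => //; rewrite ?NE ?ME dvdz_mulr.
  have g0 : gcdz a b != 0 by rewrite gcdz_eq0 negb_and b0 orbT.
  have gd : (gcdz a b ^+ 2 %| d)%Z.
    apply: (dvdz_square_mulr _ _ _ _ _ h); rewrite ?dvdz_gcdl ?dvdz_gcdr //.
    by apply: coprimez_dvdl coaD; exact: dvdz_gcdl.
  apply: (@le_trans _ _ (36 * gcdz a b ^+ 4)).
    have g4 : 0 < 36 * gcdz a b ^+ 4 by rewrite mulr_gt0 // exprn_gt0 // lt_def g0.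
    rewrite -[X in _ <= X](gtr0_norm g4) -!abszE lez_nat.
    by apply: dvdn_leq kdiv; rewrite absz_gt0 gt_eqF.
  rewrite ler_pM2l // lerXn2r ?nnegrE //.
    by apply: le_trans (hT _ gd).
  by rewrite -[X in X <= _]ger0_norm // hT.
have uE : `|a| ^+ 3 = `|a ^+ 3| by rewrite normrX.
have vE : `|d| * D ^+ 3 = `|d * D ^+ 3| by rewrite normrM normrX (gtr0_norm D0).
have E1 : `|N| ^+ 3 = `|a ^+ 3| * `|a ^+ 3 - 8 * (d * D ^+ 3)| ^+ 3.
  by rewrite /N normrM exprMn normrX.
have E2 : `|d| * `|M| ^+ 3 = 64 * (`|d * D ^+ 3| * `|a ^+ 3 + d * D ^+ 3| ^+ 3).
  rewrite -h -vE /M (normrM (4 * D)) (normrM 4) (gtr0_norm D0); set B := `|b ^+ 2|.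
  by rewrite (ger0_norm (_ : 0 <= 4)) //; ring.
have E3 : Num.max (`|N| ^+ 3) (`|d| * `|M| ^+ 3) =
   `|k| ^+ 3 * Num.max (`|numq z.1| ^+ 3) (`|d| * denq z.1 ^+ 3).
  rewrite NE ME (normrM k) (normrM k) (gtr0_norm (denq_gt0 _)) !exprMn.
  by rewrite (mulrCA `|d|) maxr_pMr // exprn_ge0.
have := duplication_upper (a ^+ 3) (d * D ^+ 3).
have := duplication_lower (a ^+ 3) (d * D ^+ 3).
rewrite -E1 -E2 E3 -uE -vE.
set H := Num.max _ _; set H' := Num.max _ _ => lo up.
have H'0 : 0 <= H' by rewrite le_max exprn_ge0.
split=> //.
  apply: le_trans lo _.
  have -> : (72 * T ^+ 4) ^+ 3 * H' = 8 * ((36 * T ^+ 4) ^+ 3 * H') by ring.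
  rewrite ler_pM2l // ler_wpM2r // lerXn2r ?nnegrE //.
  by apply: le_trans kT.
apply: le_trans up; rewrite ler_peMl // exprn_ege1 //.
by rewrite -gtz0_ge1 normr_gt0.
Qed.

(** In the factor [1 / 6], a half comes from the normalization of the canonical
    height and a third from [curve_height] being a cube. *)
Lemma canonical_height_lower (R : realType) (d T : int) (P : ratpoint d) x y :
    d != 0 -> (forall r : int, (r ^+ 2 %| d)%Z -> `|r| <= T) ->
    ~ torsion P -> coords P = Some (x, y) ->
  (ln ((curve_height d x)%:~R : R) - ln ((72 * T ^+ 4)%:~R)) / 6 <=
  canonical_height R P.
Proof.
move=> d0 hT nt PE.
pose Q n := coords (mul_point (2 ^ n) P).
pose X n := if Q n is Some p then p.1 else 0.
have QE n : exists x y, [/\ Q n = Some (x, y), y != 0 & X n = x].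
  have [|x' [y' [e y0]]] := @nontorsion_mul_Some _ _ nt (2 ^ n)%N.
    by rewrite expn_gt0.
  by exists x', y'; rewrite /X /Q e.
have T1 : 1 <= T by have := hT 1; rewrite expr1n dvd1z => /(_ isT).
have hstep n : curve_height d (X n) ^+ 4 <= (72 * T ^+ 4) ^+ 3 * curve_height d (X n.+1) /\
   curve_height d (X n.+1) <= 729 * curve_height d (X n) ^+ 4.
  have [x' [y' [QnE y0 ->]]] := QE n.
  have hc : on_curve d (Some (x', y')) by rewrite -QnE; exact: valP.
  have [z [zE z1 z2]] := curve_height_double _ _ _ _ hc y0 d0 hT.
  have QS : Q n.+1 = Some z.
    by rewrite -zE -QnE /Q expnS mul2n mul_point_double // expn_gt0.
  by rewrite [X n.+1]/X QS.
have X0 : X 0%N = x.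
  by rewrite /X /Q expn0 /mul_point /= PE.
rewrite /canonical_height.
pose m n : int := Num.max `|numq (X n)| (denq (X n)).
have -> : (fun n => (4 ^+ n)^-1 * log_height R (xcoord (mul_point (2 ^ n) P))) =
  (fun n => (4 ^+ n)^-1 * ln ((m n)%:~R : R)).
  apply/funext => n; congr (_ * _); rewrite /log_height /xcoord.
  have [x' [y' [QnE _ XE]]] := QE n; move: QnE; rewrite /Q => ->.
  by rewrite /m XE /= (gtr0_norm (denq_gt0 _)).
have := @tate_limit_lower R (fun n => (curve_height d (X n))%:~R) (fun n => (m n)%:~R)
   (72 * T ^+ 4)%:~R `|d|%:~R 729%:~R.
rewrite X0 => h; suff : forall a b : R, a / 3 <= b -> a / 6 <= 2^-1 * b.
  apply; apply: h.
all: try by move=> a b; lra.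
all: try by move=> n; rewrite -?rmorphXn -?rmorphM ler_int; case: (hstep n).
- by move=> n; rewrite ler1z curve_height_ge1.
- by move=> n; rewrite ler1z le_max -!gtz0_ge1 denq_gt0 orbT.
- by rewrite ler1z mulr_ege1 // exprn_ege1.
- by rewrite ler1z -gtz0_ge1 normr_gt0.
- by rewrite ler1z.
- move=> n; rewrite -rmorphXn ler_int /m /curve_height.
  have D1 : denq (X n) ^+ 3 <= `|d| * denq (X n) ^+ 3.
    rewrite ler_peMl //; first exact/exprn_ge0/ltW/denq_gt0.
    by rewrite -gtz0_ge1 normr_gt0.
  rewrite le_max; case: (leP `|numq (X n)| (denq (X n))) => _; last by rewrite lexx.
  by rewrite D1 orbT.
- move=> n; rewrite -rmorphXn -rmorphM ler_int /m /curve_height.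
  have d1 : 1 <= `|d| by rewrite -gtz0_ge1 normr_gt0.
  set M := Num.max `|_| _.
  have aM : `|numq (X n)| <= M by rewrite le_max lexx.
  have DM : denq (X n) <= M by rewrite le_max lexx orbT.
  have M0 : 0 <= M by apply: le_trans aM.
  have D0 : 0 <= denq (X n) by exact/ltW/denq_gt0.
  rewrite ge_max; apply/andP; split.
    apply: (@le_trans _ _ (M ^+ 3)); first by rewrite lerXn2r.
    by rewrite ler_peMl // exprn_ge0.
  by rewrite ler_pM2l ?lerXn2r // lt_le_trans //.
Qed.

(** * The least height of a non-torsion point *)

(** A bound on [curve_height] confines the point to a finite box. *)
Lemma curve_height_bounds d x y : d != 0 -> on_curve d (Some (x, y)) ->
  [/\ `|numq x| <= curve_height d x, `|denq x| <= curve_height d x,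
      numq y ^+ 2 <= 2 * curve_height d x & denq y ^+ 2 <= curve_height d x].
Proof.
move=> d0 hc; have [h h'] := rat_curve_reduced _ _ _ hc.
have D3 : 0 <= denq x ^+ 3 by exact/exprn_ge0/ltW/denq_gt0.
have d1 : 1 <= `|d| by rewrite -gtz0_ge1 normr_gt0.
have a1 : `|numq x| ^+ 3 <= curve_height d x by rewrite le_max lexx.
have D1 : `|d| * denq x ^+ 3 <= curve_height d x by rewrite le_max lexx orbT.
have D2 : denq x ^+ 3 <= curve_height d x by apply: le_trans D1; rewrite ler_peMl.
have ge1_cube (k : int) : 0 <= k -> k <= k ^+ 3.
  rewrite le0r => /orP[/eqP -> //|k0]; rewrite -{1}[k]expr1.
  by apply: ler_weXn2l; rewrite // -gtz0_ge1.
split.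
- by apply: le_trans a1; apply: ge1_cube.
- by rewrite gtr0_norm ?denq_gt0 //; apply: le_trans (ge1_cube _ (ltW (denq_gt0 x))) D2.
- rewrite h; apply: le_trans (ler_norm _) _; apply: le_trans (ler_normD _ _) _.
  rewrite normrX normrM (ger0_norm D3).
  by rewrite mulr2n mulrDl mul1r lerD.
- by rewrite h'.
Qed.

Lemma finite_int_ball (N : int) : finite_set [set z : int | `|z| <= N].
Proof.
apply: (@sub_finite_set _ _ ((fun k : nat => k%:Z - N) @` `I_(2 * `|N|).+1)).
  by move=> z /= zN; exists `|(z + N)%R|%N; lia.
exact/finite_image/finite_II.
Qed.

Lemma finite_curve_height_le d (N : int) : d != 0 ->
  finite_set [set P : ratpoint d | exists x y,
    coords P = Some (x, y) /\ curve_height d x <= N].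
Proof.
move=> d0; pose ball := [set z : int | `|z| <= 2 * N].
(* A point is recovered from the numerators and denominators of its
   coordinates. *)
pose f (q : (int * int) * (int * int)) : ratpoint d := insubd (origin d)
  (Some (q.1.1%:~R / q.1.2%:~R, q.2.1%:~R / q.2.2%:~R)).
apply: (@sub_finite_set _ _ (f @` ((ball `*` ball) `*` (ball `*` ball)))); last first.
  by apply: finite_image; do !apply: finite_setX; exact: finite_int_ball.
move=> P [x [y [PE HN]]]; exists ((numq x, denq x), (numq y, denq y)); last first.
  by apply: val_inj; rewrite /f /= !divq_num_den val_insubd -PE valP.
have hc : on_curve d (Some (x, y)) by rewrite -PE; exact: valP.
have [h1 h2 h3 h4] := curve_height_bounds _ _ _ d0 hc.
have h0 := curve_height_ge1 d x d0.
have sq (z : int) : `|z| <= z ^+ 2 by nia.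
have := sq (numq y); have := sq (denq y); rewrite /ball.
by split; split=> /=; lia.
Qed.

Lemma finite_has_min (R : realType) (A : set R) : finite_set A -> A !=set0 ->
  exists2 m, A m & lbound A m.
Proof.
move=> /finite_seqP[s ->]; elim: s => [[x //]|a [|b s] IH _].
  by exists a; rewrite /= ?mem_head // => x; rewrite /= inE => /eqP ->.
have [|m ms lm] := IH; first by exists b; rewrite /= mem_head.
exists (Num.min a m).
  by rewrite /= inE; case: leP => _; rewrite ?eqxx //; move: ms => /= ->; rewrite orbT.
move=> x; rewrite /= inE => /orP[/eqP ->|xs]; first by rewrite ge_min lexx.
by rewrite ge_min lm ?orbT.
Qed.

Lemma nontorsion_coords (d : int) (P : ratpoint d) : ~ torsion P ->
  exists x y, coords P = Some (x, y).
Proof.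
move=> nt; have [x [y [e _]]] := @nontorsion_mul_Some _ _ nt 1 isT.
by exists x, y; rewrite -e /mul_point /=; case: (coords P) => [[]|].
Qed.

Lemma square_divisor_le (d r : int) : d != 0 -> (r ^+ 2 %| d)%Z -> `|r| <= `|d|.
Proof.
move=> d0; rewrite dvdzE => /dvdn_leq; rewrite absz_gt0 => /(_ d0).
by rewrite abszX; nia.
Qed.

(** Northcott's property: by [canonical_height_lower] with [T = |d|], a bound on
    the canonical height bounds [curve_height], leaving finitely many points. *)
Lemma nontorsion_heights_min (R : realType) (d : int) : d != 0 ->
  @nontorsion_heights R d !=set0 ->
  exists2 m, nontorsion_heights d m & lbound (@nontorsion_heights R d) m.
Proof.
move=> d0 [h0 [P0 nt0 _]].
pose M := canonical_height R P0.
pose A := [set canonical_height R P | P in [set P : ratpoint d | ~ torsion P /\ canonical_height R P <= M]].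
have finA : finite_set A.
  apply: finite_image.
  pose K : R := (72 * `|d| ^+ 4)%:~R.
  pose N : int := (Num.truncn (expR (6 * M + ln K)))%:Z.
  apply: sub_finite_set (finite_curve_height_le d N d0) => P [nt hM].
  have [x [y PE]] := nontorsion_coords _ _ nt.
  exists x, y; split=> //.
  have := @canonical_height_lower R d `|d| P x y d0 (fun r => @square_divisor_le d r d0) nt PE.
  rewrite -/K => h.
  have H1 := curve_height_ge1 d x d0.
  have H0 : 0 < (curve_height d x)%:~R :> R by rewrite ltr0z; apply: lt_le_trans H1.
  have : (curve_height d x)%:~R <= expR (6 * M + ln K).
    by rewrite -[X in X <= _]lnK ?posrE // ler_expR; lra.
  have -> : curve_height d x = `|curve_height d x|%N by rewrite gez0_abs //; apply: le_trans H1.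
  rewrite -[X in X <= _]/(`|curve_height d x|%N%:R) lez_nat => h'.
  by rewrite truncn_ge_nat // (le_trans _ h').
have [|m [P [nt PM] <-] lm] := finite_has_min _ _ finA.
  by exists M; exists P0 => //; split=> //; exact: lexx.
exists (canonical_height R P); first by exists P.
move=> _ [Q ntQ <-].
have [QM|MQ] := boolP (canonical_height R Q <= M); first
  exact: (lm _ (ex_intro2 _ _ Q (conj ntQ QM) erefl)).
by rewrite -ltNge in MQ; apply: le_trans PM _; apply: ltW.
Qed.

Lemma log_zeta_gt (R : realType) (d : int) (c : R) : d != 0 ->
  (forall P : ratpoint d, ~ torsion P -> c < canonical_height R P) ->
  (c%:E < log_zeta R d)%E.
Proof.
move=> d0 h; rewrite /log_zeta; case: pselect => [e|ne]; first exact: ltry.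
have [|m m1 m2] := @nontorsion_heights_min R d d0; first exact/set0P/eqP.
set A := [set m | _]; have : A (xget 0 A) by apply: xgetPex; exists m.
by move=> [[P nt <-] _]; rewrite lte_fin; apply: h.
Qed.

(** * Counting exceptional integers *)

Lemma card_fset_set_le (T : choiceType) (A : set T) (s : seq T) :
  A `<=` [set` s] -> (#|` fset_set A| <= size s)%N.
Proof.
move=> As; have fA : finite_set A by apply: sub_finite_set As _; exact: finite_seq.
apply: (@leq_trans #|` [fset x in s]%fset|).
  apply: fsubset_leq_card; apply/fsubsetP => x; rewrite in_fset_set // inE => /As.
  by rewrite !inE.
by rewrite card_fseq size_undup.
Qed.

(** [1 / r^2 <= 1 / (r - 1) - 1 / r] telescopes. *)
Lemma sum_divn_square_tail (M t n : nat) : (0 < t)%N ->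
  (t * \sum_(r <- iota t.+1 n) M %/ r ^ 2 <= M)%N.
Proof.
move=> t0; rewrite -(@ler_nat rat) natrM natr_sum.
have tp : 0 < t%:R :> rat by rewrite ltr0n.
suff : \sum_(r <- iota t.+1 n) (M %/ r ^ 2)%:R <= M%:R / t%:R - M%:R / (t + n)%:R :> rat.
  move=> h; rewrite mulrC -ler_pdivlMr //; apply: le_trans h _.
  by rewrite lerBlDr lerDl divr_ge0.
elim: n => [|n IH]; first by rewrite addn0 subrr big_nil.
rewrite -[in iota _ _](addn1 n) iotaD big_cat /= big_cons big_nil addr0.
set r := (t.+1 + n)%N; have rE : (t + n.+1)%N = r by rewrite addnS.
have r'E : (t + n)%:R = r%:R - 1 :> rat by rewrite /r addSn -natr1 addrK.
have r1 : 1 < r%:R :> rat by rewrite ltr1n /r addSn ltnS ltn_addr.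
rewrite rE; rewrite r'E in IH.
apply: le_trans (lerD IH (le_refl _)) _; rewrite -lerBrDl.
have hd : (M %/ r ^ 2)%:R <= M%:R / r%:R ^+ 2 :> rat.
  by rewrite ler_pdivlMr ?exprn_gt0 ?(lt_trans _ r1) // -natrX -natrM ler_nat leq_divM.
apply: le_trans hd _.
have -> : M%:R / t%:R - M%:R / r%:R - (M%:R / t%:R - M%:R / (r%:R - 1)) =
   M%:R / (r%:R * (r%:R - 1)) :> rat.
  by field; rewrite !gt_eqF //; lra.
rewrite ler_wpM2l // lef_pV2 ?posrE ?exprn_gt0 ?mulr_gt0 //; nra.
Qed.

Definition multiples (q M : nat) := [seq (q * k.+1)%N | k <- iota 0 (M %/ q)].

Lemma mem_multiples (q M n : nat) :
  (0 < q)%N -> (0 < n <= M)%N -> (q %| n)%N -> n \in multiples q M.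
Proof.
move=> q0 /andP[n0 nM] /dvdnP[k kE].
have k0 : (0 < k)%N by case: k kE n0 => // ->.
apply/mapP; exists k.-1; last by rewrite prednK // mulnC.
by rewrite mem_iota /= add0n prednK // leq_divRL // -kE.
Qed.

Lemma size_multiples (q M : nat) : size (multiples q M) = (M %/ q)%N.
Proof. by rewrite size_map size_iota. Qed.

Definition ball_seq (N : nat) : seq int := [seq k%:Z - N%:Z | k <- iota 0 (2 * N).+1].

Lemma mem_ball_seq (N : nat) (z : int) : `|z| <= N%:Z -> z \in ball_seq N.
Proof.
move=> zN; apply/mapP; exists `|(z + N%:Z)%R|%N; last by lia.
by rewrite mem_iota; lia.
Qed.

Lemma size_ball_seq N : size (ball_seq N) = (2 * N).+1.
Proof. by rewrite size_map size_iota. Qed.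

Section Exceptional.
Variable t : nat.
Hypothesis t0 : (0 < t)%N.

(** Here [t] stands for [B^(1/200)]. The last case catches every [d] above
    [t^198] that has a point of [curve_height] below [t^216], whence the
    exponents [72 = 216 / 3], [108 = 216 / 2] and [6 = (216 - 198) / 3]. *)
Definition exceptional (d : int) : Prop :=
  [\/ `|d| <= (t ^ 198)%:Z,
      exists2 r : int, t%:Z < `|r| & (r ^+ 2 %| d)%Z |
      exists a b D : int, [/\ `|a| <= (t ^ 72)%:Z, `|b| <= (2 * t ^ 108)%:Z,
         0 < D <= (t ^ 6)%:Z & b ^+ 2 = a ^+ 3 + d * D ^+ 3]].

Let M := (t ^ 200)%N.

Let square_multiples := flatten [seq multiples (r ^ 2) M | r <- iota t.+1 M].

Let exceptional_seq : seq int :=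
  ball_seq (t ^ 198) ++
  ([seq n%:Z | n <- square_multiples] ++ [seq - n%:Z | n <- square_multiples]) ++
  [seq ((p.1 ^+ 2 - p.2 ^+ 3) %/ (D.+1%:Z ^+ 3))%Z
    | p <- [seq (b, a) | b <- ball_seq (2 * t ^ 108), a <- ball_seq (t ^ 72)],
      D <- iota 0 (t ^ 6)].

Let mem_exceptional_seq (d : int) : d != 0 -> `|d| <= M%:Z -> exceptional d ->
  d \in exceptional_seq.
Proof.
move=> d0 dM; rewrite 3!mem_cat => -[h1|[r rt rd]|[a [b [D [ha hb /andP[D0 D1] h]]]]].
- by rewrite mem_ball_seq.
- apply/orP; right; apply/orP; left.
  have : `|d|%N \in square_multiples.
    apply/flattenP; exists (multiples (`|r| ^ 2) M).
      apply: map_f; rewrite mem_iota.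
      have : (`|r| ^ 2 <= `|d|)%N.
        by rewrite -abszX; apply: dvdn_leq rd; rewrite absz_gt0.
      by nia.
    apply: mem_multiples.
    - by rewrite expn_gt0; lia.
    - by rewrite absz_gt0 d0 /=; lia.
    - by rewrite -abszX -dvdzE.
  move=> hin; case: (ltP d 0) => [dlt|dge].
    by apply/orP; right; apply/mapP; exists `|d|%N => //; lia.
  by apply/orP; left; apply/mapP; exists `|d|%N => //; lia.
- apply/orP; right; apply/orP; right.
  have -> : d = (((b, a).1 ^+ 2 - (b, a).2 ^+ 3) %/ ((`|D|.-1).+1%:Z ^+ 3))%Z.
    rewrite prednK ?absz_gt0 ?gt_eqF // gtz0_abs //.
    by rewrite h addrAC subrr add0r mulzK // expf_neq0 // gt_eqF.
  apply: (allpairs_f (fun p D => ((p.1 ^+ 2 - p.2 ^+ 3) %/ (D.+1%:Z ^+ 3))%Z)).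
    by apply: allpairs_f; rewrite mem_ball_seq.
  by rewrite mem_iota /= add0n prednK ?absz_gt0 ?gt_eqF // -lez_nat gtz0_abs.
Qed.

Let size_square_multiples : (size square_multiples <= t ^ 199)%N.
Proof.
rewrite size_flatten /shape -map_comp sumnE big_map.
under eq_bigr do rewrite /= size_multiples.
have := sum_divn_square_tail M t M t0.
by rewrite /M expnS leq_pmul2l.
Qed.

(** Each of the three kinds of exceptions is enumerated by an explicit list, of
    size at most [3 t^199], [2 t^199] and [15 t^199] respectively. *)
Lemma card_exceptional (A : set int) :
  (forall d, A d -> [/\ d != 0, `|d| <= M%:Z & exceptional d]) ->
  (#|` fset_set A| <= 20 * t ^ 199)%N.
Proof.
move=> hA; apply: (@leq_trans (size exceptional_seq)).
  by apply: card_fset_set_le => d /hA[d0 dM ex]; apply: mem_exceptional_seq.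
rewrite 3!size_cat 2!size_allpairs 3!size_ball_seq 2!size_map size_iota.
have h1 : (t ^ 198 <= t ^ 199)%N by rewrite leq_pexp2l.
have h2 : (t ^ 72 * t ^ 108 * t ^ 6 <= t ^ 199)%N by rewrite -!expnD leq_pexp2l.
have p1 : (0 < t ^ 198)%N by rewrite expn_gt0 t0.
have p2 : (0 < t ^ 72)%N by rewrite expn_gt0 t0.
have p3 : (0 < t ^ 108)%N by rewrite expn_gt0 t0.
move: size_square_multiples h1 h2 p1 p2 p3; clear.
move: (size _) (t ^ 198)%N (t ^ 72)%N (t ^ 108)%N (t ^ 6)%N (t ^ 199)%N.
move=> s x a b c e se xe abce x0 a0 b0.
have : ((2 * (2 * b)).+1 * (2 * a).+1 * c <= 15 * (a * b * c))%N.
  rewrite (_ : 15 * (a * b * c) = (5 * b) * (3 * a) * c)%N; last by ring.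
  by rewrite leq_mul2r; apply/orP; right; apply: leq_mul; lia.
by lia.
Qed.
End Exceptional.

(** Among [1, ..., N], those divisible by some [r^6] with [r >= 2] number at most
    [sum N / r^6 <= (1/2) sum N / r^2 <= N / 2]. *)
Lemma card_S6_ge (R : realType) (B : R) : (Num.truncn B <= 2 * #|` fset_set (S6 B)|)%N.
Proof.
set N := Num.truncn B.
pose L := flatten [seq multiples (r ^ 6) N | r <- iota 2 N].
have sizeL : (2 * size L <= N)%N.
  rewrite size_flatten /shape -map_comp sumnE big_map big_distrr /=.
  apply: leq_trans (sum_divn_square_tail N 1 N isT); rewrite mul1n.
  rewrite big_seq [X in (_ <= X)%N]big_seq; apply: leq_sum => r; rewrite mem_iota => /andP[r2 _].
  rewrite size_multiples; have r0 : (0 < r ^ 2)%N by rewrite expn_gt0; lia.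
  rewrite leq_divRL //; apply: leq_trans (leq_divM N (r ^ 6)).
  rewrite [X in (_ <= _ * X)%N](expnD r 4 2) mulnA leq_mul2r mulnC leq_mul2l.
  apply/orP; right; apply/orP; right; apply: leq_trans r2 _.
  by rewrite -{1}[r]expn1 leq_pexp2l //; lia.
have cov : ([fset x in map Posz (iota 1 N)] `<=`
   fset_set (S6 B) `|` [fset x in map Posz L])%fset.
  apply/fsubsetP => x; rewrite !inE /= => /mapP[n nN ->{x}].
  rewrite mem_iota in nN; rewrite in_fset_set; last exact: finite_S6.
  have [/mapP[m mL ->]|nL] := boolP (n%:Z \in map Posz L).
    by rewrite orbT.
  rewrite orbF inE; split.
    have n0 : (0 < n)%N by lia.
    by rewrite -[X in X <= _]/(n%:R) -(prednK n0) -truncn_gt_nat -/N prednK; lia.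
  split; first by lia.
  move=> p pp; apply: contra nL; rewrite dvdzE abszX /= => pn.
  apply: map_f; apply/flattenP; exists (multiples (p ^ 6) N).
    apply: map_f; rewrite mem_iota prime_gt1 //=.
    have : (p ^ 6 <= n)%N by apply: dvdn_leq pn; lia.
    have : (p <= p ^ 6)%N by rewrite -{1}[p]expn1 leq_pexp2l // prime_gt0.
    by lia.
  by apply: mem_multiples => //; rewrite ?expn_gt0 ?prime_gt0 //; lia.
have := fsubset_leq_card cov; rewrite card_fseq undup_id; last first.
  by rewrite map_inj_uniq ?iota_uniq // => i j [].
rewrite size_map size_iota => h.
have h2 := leq_trans h (leq_card_fsetU _ _).
have h3 : (#|` [fset x in map Posz L]%fset| <= size L)%N.
  by rewrite card_fseq (leq_trans (size_undup _)) // size_map.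
by lia.
Qed.

(** * Density *)

Lemma nonexceptional_curve_height (t : nat) (d : int) (x y : rat) :
    (0 < t)%N -> d != 0 -> on_curve d (Some (x, y)) -> ~ exceptional t d ->
  (t ^ 216)%:Z <= curve_height d x.
Proof.
move=> t0 d0 hc ne; rewrite leNgt; apply/negP => H; apply: ne.
have [dt|dt] := leP `|d| (t ^ 198)%:Z; first by constructor 1.
constructor 3; exists (numq x), (numq y), (denq x).
have [h _] := rat_curve_reduced _ _ _ hc.
have [_ _ h3 _] := curve_height_bounds _ _ _ d0 hc.
have a1 : `|numq x| ^+ 3 <= curve_height d x by rewrite le_max lexx.
have D1 : `|d| * denq x ^+ 3 <= curve_height d x by rewrite le_max lexx orbT.
have tZ k : (t ^ k)%:Z = t%:Z ^+ k by rewrite -natz natrX natz.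
split=> //.
- rewrite -(@ler_pXn2r _ 3%N) ?nnegrE // tZ -exprM -tZ.
  exact/ltW/(le_lt_trans a1).
- rewrite -(@ler_pXn2r _ 2%N) ?nnegrE // real_normK ?num_real //.
  rewrite PoszM tZ exprMn -exprM -tZ; apply: (le_trans h3).
  have H0 : 0 <= curve_height d x by apply: le_trans a1; rewrite exprn_ge0.
  by apply: ler_pM => //; exact: ltW.
- rewrite denq_gt0 /= -(@ler_pXn2r _ 3%N) ?nnegrE // ?(ltW (denq_gt0 _)) //.
  rewrite tZ -exprM -tZ; apply: ltW; rewrite -(ltr_pM2l (x := (t ^ 198)%:Z)); last first.
    by rewrite ltz_nat expn_gt0 t0.
  apply: (@le_lt_trans _ _ (`|d| * denq x ^+ 3)).
    by rewrite ler_wpM2r ?exprn_ge0 ?(ltW (denq_gt0 _)) // ltW.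
  apply: (le_lt_trans D1); apply: (lt_le_trans H).
  by rewrite !tZ -exprD.
Qed.

(** [6 hhat(P) >= 216 ln t - ln 72 - 4 ln t > 211 ln t] as soon as [t > 72]. *)
Lemma nonexceptional_canonical_height (R : realType) (t : nat) (d : int)
    (P : ratpoint d) :
    (73 <= t)%N -> d != 0 -> ~ exceptional t d -> ~ torsion P ->
  35 * ln (t%:R : R) < canonical_height R P.
Proof.
move=> t73 d0 ne nt.
have t0 : (0 < t)%N by apply: leq_trans t73.
have tR : 0 < t%:R :> R by rewrite ltr0n.
have [x [y PE]] := nontorsion_coords _ _ nt.
have hc : on_curve d (Some (x, y)) by rewrite -PE; exact: valP.
have hT (r : int) : (r ^+ 2 %| d)%Z -> `|r| <= t%:Z.
  move=> rd; rewrite leNgt; apply/negP => tr; apply: ne.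
  by constructor 2; exists r.
apply: lt_le_trans (@canonical_height_lower R d t%:Z P x y d0 hT nt PE).
have h1 : 216 * ln (t%:R : R) <= ln ((curve_height d x)%:~R).
  have -> : 216 * ln (t%:R : R) = ln (t%:R ^+ 216) by rewrite lnXn // mulr_natl.
  have H := nonexceptional_curve_height t d x y t0 d0 hc ne.
  have e : t%:R ^+ 216 = ((t ^ 216)%:Z)%:~R :> R by rewrite -natrX.
  rewrite e ler_ln ?posrE ?ltr0z ?ler_int // ?ltz_nat ?expn_gt0 ?t0 //.
  by apply: lt_le_trans H; rewrite ltz_nat expn_gt0 t0.
have h2 : ln ((72 * t%:Z ^+ 4)%:~R : R) = ln 72 + 4 * ln (t%:R).
  by rewrite rmorphM rmorphXn /= lnM ?posrE ?exprn_gt0 // lnXn // mulr_natl.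
have h3 : ln 72 < ln (t%:R : R) by rewrite ltr_ln ?posrE // ltr_nat.
have h4 : 0 <= ln (t%:R : R) by rewrite ln_ge0 // ler1n.
by rewrite h2 ltr_pdivlMr //; lra.
Qed.

Lemma nonexceptional_large_zeta (R : realType) (eps B : R) (t : nat) (d : int) :
    0 < eps -> (73 <= t)%N -> B <= t%:R ^+ 200 -> S6 B d -> ~ exceptional t d ->
  large_zeta eps B d.
Proof.
move=> heps t73 Bt Sd ne; split=> //; case: (Sd) => dB [d0 _].
have L := @log_zeta_gt R d (35 * ln t%:R) d0
  (fun P => @nonexceptional_canonical_height R t d P t73 d0 ne).
rewrite -lte_expeR in L; apply: le_lt_trans L; rewrite /= lee_fin.
have tR : 0 < t%:R :> R by rewrite ltr0n; apply: leq_trans t73.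
have d1 : 1 <= `|d|%:~R :> R by rewrite ler1z -gtz0_ge1 normr_gt0.
have lnd : 0 <= ln (`|d|%:~R : R) by rewrite ln_ge0.
have lndt : ln (`|d|%:~R : R) <= 200 * ln t%:R.
  rewrite mulr_natl -lnXn // ler_ln ?posrE ?exprn_gt0 ?(lt_le_trans _ d1) //.
  exact: le_trans dB Bt.
rewrite /powR gt_eqF ?(lt_le_trans _ d1) // ler_expR.
have : eps * ln (`|d|%:~R : R) >= 0 by rewrite mulr_ge0 // ltW.
by rewrite mulrBl; lra.
Qed.

Lemma pow200_bracket (R : realType) (B : R) (m : nat) : m%:R ^+ 200 <= B ->
  exists t : nat, [/\ (m < t)%N, t.-1%:R ^+ 200 <= B & B < t%:R ^+ 200].
Proof.
move=> mB.
have ex : exists t : nat, B < t%:R ^+ 200.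
  exists (Num.truncn B).+1; apply: lt_le_trans (truncnS_gt B) _.
  by rewrite -[X in X <= _]expr1 ler_weXn2l // ler1n.
have mono (i j : nat) : (i <= j)%N -> i%:R ^+ 200 <= j%:R ^+ 200 :> R.
  by move=> ij; rewrite lerXn2r ?nnegrE // ler_nat.
case: (ex_minnP ex) => t tB tmin.
have mt : (m < t)%N.
  by rewrite ltnNge; apply/negP => /mono h; have := le_lt_trans (le_trans h mB) tB; rewrite ltxx.
exists t; split=> //; rewrite leNgt; apply/negP => /tmin.
by case: t mt {tB tmin} => // t _; rewrite /= ltnn.
Qed.

Lemma card_large_zeta (R : realType) (eps B : R) (t : nat) :
    0 < eps -> (73 <= t)%N -> B <= t%:R ^+ 200 ->
  (#|` fset_set (S6 B)| <= #|` fset_set (large_zeta eps B)| + 20 * t ^ 199)%N.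
Proof.
move=> heps t73 Bt.
have finL : finite_set (large_zeta eps B).
  by apply: sub_finite_set (finite_S6 B) => d [].
have finE : finite_set (S6 B `\` large_zeta eps B).
  by apply: sub_finite_set (finite_S6 B) => d [].
apply: (@leq_trans #|` fset_set (large_zeta eps B) `|` fset_set (S6 B `\` large_zeta eps B)|%fset).
  apply: fsubset_leq_card; apply/fsubsetP => d.
  rewrite inE !in_fset_set //; last exact: finite_S6.
  rewrite !inE => Sd; have [Ld|nLd] := pselect (large_zeta eps B d).
    by apply/orP; left; rewrite inE.
  by apply/orP; right; rewrite inE.
apply: leq_trans (leq_card_fsetU _ _) _; rewrite leq_add2l.
apply: card_exceptional; first by apply: leq_trans t73.
move=> d [Sd nL]; case: (Sd) => dB [d0 _]; split=> //.
  by rewrite -(@ler_int R) (le_trans dB) // (le_trans Bt) // -natrX.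
by apply: contrapT => ne; apply: nL; apply: nonexceptional_large_zeta t73 Bt Sd ne.
Qed.

Theorem theorem1p6 (R : realType) (eps : R) (heps : 0 < eps) :
  card_set R (large_zeta eps B) / card_set R (S6 B) @[B --> +oo] --> (1 : R).
Proof.
apply/cvgrPdist_le => e e0.
(* With [S] the cardinal of [S6 B], [2 S >= floor B >= (t - 1)^200 >= (t / 2)^200],
   against at most [20 t^199] exceptions: their proportion is at most [C / t]. *)
pose C : R := 20 * 2 ^+ 201.
pose m := (73 + Num.truncn (C / e))%N.
near=> B.
have mB : m%:R ^+ 200 <= B by near: B; apply: nbhs_pinfty_ge; rewrite num_real.
have [t [mt tB Bt]] := @pow200_bracket R B m mB.
have t73 : (73 <= t)%N by apply: leq_trans (ltnW mt); rewrite leq_addr.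
have t2 : (t <= 2 * t.-1)%N by clear -t73; lia.
have Ct : C / e <= t%:R.
  apply: ltW; apply: lt_le_trans (truncnS_gt _) _; rewrite ler_nat.
  by apply: leq_trans mt; rewrite ltnS leq_addl.
have hL := @card_large_zeta R eps B t heps t73 (ltW Bt).
have hS := @card_S6_ge R B.
rewrite /card_set; set L : nat := #|` fset_set (large_zeta eps B)| in hL *.
set S : nat := #|` fset_set (S6 B)| in hL hS *.
have LS : (L <= S)%N.
  apply: fsubset_leq_card; rewrite -fset_set_sub; [by move=> d []| |exact: finite_S6].
  by apply: sub_finite_set (finite_S6 B) => d [].
have B0 : 0 <= B by apply: le_trans mB; rewrite exprn_ge0.
have tS : t%:R ^+ 200 <= 2 ^+ 201 * S%:R :> R.
  have h1 : t.-1%:R ^+ 200 <= 2 * S%:R :> R.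
    rewrite -natrX -natrM ler_nat; apply: leq_trans hS.
    by rewrite truncn_ge_nat // natrX.
  have h2 : t%:R <= 2 * t.-1%:R :> R by rewrite -natrM ler_nat.
  apply: (@le_trans _ _ ((2 * t.-1%:R) ^+ 200)); first by rewrite lerXn2r ?nnegrE // mulr_ge0.
  by rewrite exprMn [2 ^+ 201]exprSr -mulrA ler_pM2l ?exprn_gt0.
have t0 : 0 < t%:R :> R by rewrite ltr0n; apply: leq_trans t73.
have S0 : 0 < S%:R :> R.
  have := lt_le_trans (exprn_gt0 200 t0) tS.
  by rewrite pmulr_rgt0 // exprn_gt0.
have -> : 1 - L%:R / S%:R = (S - L)%N%:R / S%:R :> R.
  by rewrite natrB // mulrBl divff // gt_eqF.
rewrite ger0_norm ?divr_ge0 // ler_pdivrMr //.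
apply: (@le_trans _ _ (20 * t%:R ^+ 199)).
  by rewrite -natrX -natrM ler_nat leq_subLR.
rewrite -(ler_pM2r t0) -mulrA -exprSr.
apply: (@le_trans _ _ (C * S%:R)); first by rewrite /C -mulrA ler_pM2l.
by rewrite [e * _ * _]mulrAC ler_wpM2r // [e * _]mulrC -ler_pdivrMr.
Unshelve. all: by end_near.
Qed.
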